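(* Let $\alpha,\beta$ be integers different from $1$ with $v_2(\alpha-1)=1$ and $n=v_2(\beta-1)>2$. Then $|G_2|=2^{n+4}$, the nilpotency class of $G_2$ is $3$, $o(a)=o(c)=4$ and $o(b)=2^{n+1}$.
   Context: $G(\alpha,\beta)=\langle A,B\mid A^{[A,B]}=A^{\alpha},\ B^{[B,A]}=B^{\beta}\rangle$ with $[x,y]=x^{-1}y^{-1}xy$, $y^x=x^{-1}yx$, and $C=[A,B]$. The group $G(\alpha,\beta)$ is finite and nilpotent, hence the direct product of its Sylow subgroups; $G_2$ denotes its Sylow $2$-subgroup and $a,b,c$ denote the images of $A,B,C$ under the canonical projection $G(\alpha,\beta)\to G_2$. $v_2$ is the $2$-adic valuation and $o(x)$ the order of $x$. *)

(* Defs.v *)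
From mathcomp Require Import all_boot all_order all_algebra all_fingroup all_solvable.
Set Implicit Arguments. Unset Strict Implicit. Unset Printing Implicit Defensive.
Import Presentation.

Definition zexpg (gT : finGroupType) (x : gT) (z : int) : gT :=
  match z with
  | Posz n => (x ^+ n)%g
  | Negz n => (x ^- n.+1)%g
  end.

Definition zexpt (t : term) (z : int) : term :=
  match z with
  | Posz n => Exp t n
  | Negz n => Inv (Exp t n.+1)
  end.

(* the presentation < A, B | A^[A,B] = A^alpha, B^[B,A] = B^beta >,
   with [x,y] = x^-1 y^-1 x y and y^x = x^-1 y x (MathComp conventions agree) *)
Definition Gpres (alpha beta : int) : term -> Presentation.type :=
  fun a => Generator (fun b =>
    Formula (And (Eq2 (Conj a (Comm a b)) (zexpt a alpha))
                 (Eq2 (Conj b (Comm b a)) (zexpt b beta)))).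

(* Main.v *)
From HB Require Import structures.
Require Import Defs.
From mathcomp Require Import all_boot all_order all_algebra all_fingroup all_solvable.
From mathcomp Require Import ring zify.
Import GRing.Theory Num.Theory.

(** Write c = [a, b], so that a ^ c = a ^ x, b ^ (c^-1) = b ^ y and a ^ b = a c.
    Computing the conjugate of b by a ^ m, m = x ^ j, both as b (a ^ b)^-m a ^ m and
    as the conjugate of b ^ (y ^ j) by a, carried over by c ^ j, expresses a power
    of a through powers of b and c only ([mac_key]).  Comparing it with its
    conjugate by c yields a power of a lying in <b>, hence central.  This forces
    every prime divisor of #[a] to divide x - 1; if q is the least prime divisor of
    #[a] #[b], then one of a ^ (#[a] / q), b ^ (#[b] / q) and a suitable power of c
    is central and nontrivial, so the group is nilpotent by induction on its order.

    In the Sylow 2-subgroup the same relation with j = 1 gives a ^ 4 = 1,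
    c ^ 2 = a ^ 2 and b ^ (2 ^ (n + 1)) = 1, whence the upper bounds on the order
    and on the class.  They are attained by an explicit extension of Q_8 x C_2
    by a cyclic group of order 2 ^ n, and equality in the order bound forces the
    remaining invariants. *)

Set Implicit Arguments.
Unset Strict Implicit.
Unset Printing Implicit Defensive.

(** * Geometric sums *)

Local Open Scope nat_scope.

Definition gsum (r m : nat) := \sum_(i < m) r ^ i.+1.
(* [m * r ^ m - gsum r m], in a subtraction-free form (see [gsum_gdef]). *)
Definition gdef (r m : nat) := r.-1 * \sum_(i < m) i * r ^ i.

Lemma gsumSr r m : gsum r m.+1 = gsum r m + r ^ m.+1.
Proof. by rewrite /gsum big_ord_recr. Qed.

Lemma gsum_geom r m : gsum r m = r * \sum_(i < m) r ^ i.
Proof. by rewrite /gsum big_distrr; apply: eq_bigr => i _ /=; rewrite expnS. Qed.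

Lemma gsumS r m : gsum r m.+1 = r * (gsum r m).+1.
Proof. by rewrite gsum_geom big_ord_recl expn0. Qed.

Lemma gsum_pred r m : gsum r m * r.-1 = r * (r ^ m).-1.
Proof. by rewrite gsum_geom predn_exp [r.-1 * _]mulnC mulnA. Qed.

Lemma gdefS r m : gdef r m.+1 = gdef r m + r.-1 * (m * r ^ m).
Proof. by rewrite /gdef big_ord_recr mulnDr. Qed.

Lemma gsum_gdef r m : 0 < r -> gsum r m + gdef r m = m * r ^ m.
Proof.
case: r => // r _; elim: m => [|m IH]; first by rewrite /gsum /gdef !big_ord0 muln0.
rewrite gsumSr gdefS addnACA IH expnS /=; nia.
Qed.

Lemma geom_mul r p k :
  \sum_(i < p * k) r ^ i = (\sum_(i < k) r ^ i) * \sum_(i < p) (r ^ k) ^ i.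
Proof.
elim: p => [|p IH]; first by rewrite !big_ord0 muln0.
rewrite mulSnr big_split_ord /= IH big_ord_recr mulnDr; congr (_ + _).
by rewrite [RHS]mulnC big_distrr; apply: eq_bigr => i _ /=; rewrite expnD -expnM [k * p]mulnC.
Qed.

Lemma modn_expn1 q r k : 0 < r -> q %| r.-1 -> r ^ k = 1 %[mod q].
Proof.
move=> r0 qr; apply/eqP; rewrite eqn_mod_dvd ?expn_gt0 ?r0 // subn1.
exact: dvdn_trans (dvdn_pred_predX _ _).
Qed.

Lemma geom_mod q r m : 0 < r -> q %| r.-1 -> \sum_(i < m) r ^ i = m %[mod q].
Proof.
move=> r0 qr; rewrite -modn_summ (eq_bigr (fun=> 1 %% q)); last first.
  by move=> i _; apply: modn_expn1.
by rewrite modn_summ sum1_card card_ord.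
Qed.

(** Induction on [k], removing a prime factor [p]: by [geom_mul] the sum is the one for [k / p]
    times [p] powers of [r ^ (k / p)], each 1 modulo [p]. *)
Lemma dvdn_geom r k : 0 < r -> 0 < k ->
  (forall p, prime p -> p %| k -> p %| r.-1) -> k %| \sum_(i < k) r ^ i.
Proof.
move=> r0; elim/ltn_ind: k => k IH k0 hk.
have [k1|k1] := leqP k 1; first by have -> : k = 1 by lia.
have pp := pdiv_prime k1; have := pdiv_dvd k; set p := pdiv k in pp *.
case/dvdnP=> m def_k; have m0 : 0 < m by case: m def_k k0 => [->|].
have p1 := prime_gt1 pp.
rewrite def_k [m * p]mulnC geom_mul mulnC dvdn_mul //.
  apply: IH => // [|q qp qm]; first by rewrite def_k ltn_Pmulr.
  by apply: hk => //; rewrite def_k dvdn_mulr.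
have pr : p %| (r ^ m).-1.
  by apply: dvdn_trans (dvdn_pred_predX _ _); apply: hk; rewrite // def_k dvdn_mull.
by rewrite /dvdn (@geom_mod p (r ^ m) p) ?modnn ?expn_gt0 ?r0.
Qed.

Lemma dvdn_geom_mul r k m : 0 < r -> 0 < k ->
  (forall p, prime p -> p %| k -> p %| r.-1) ->
  k %| m -> k %| \sum_(i < m) r ^ i.
Proof.
move=> r0 k0 hk /dvdnP[t ->].
by rewrite geom_mul dvdn_mulr // dvdn_geom.
Qed.

Lemma totient_lt n : 1 < n -> totient n < n.
Proof.
move=> n1; rewrite totient_count_coprime big_ltn ?(ltnW n1) //.
rewrite /coprime gcdn0 (gtn_eqF n1) add0n.
apply: (@leq_ltn_trans (\sum_(1 <= i < n) 1)); first by apply: leq_sum => i _; case: (_ == _).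
by rewrite sum_nat_const_nat muln1 subn1 prednK // ltnW.
Qed.

(* The order d of x modulo q divides N, so x is prime to d and m = x ^ totient d is
   1 modulo d; if q does not divide x - 1, the last hypothesis then gives m = 1
   modulo q, whence d divides totient d, which forces d = 1. *)
Lemma prime_dvd_pred x q N : 0 < x -> 0 < N -> prime q -> coprime x N -> q %| N ->
  N %| (x ^ N).-1 ->
  (forall j, N %| gdef x (x ^ j) * x.-1 ^ 2) ->
  q %| x.-1.
Proof.
move=> x0 N0 qp cxN qN dvdN dvdT; apply: contraT => nqx.
pose z : 'F_q := (x%:R)%R.
have F0 k : (k%:R == 0 :> 'F_q)%R = (q %| k) by rewrite -(dvdn_pcharf (pchar_Fp qp)).
have xE : (z = 1 + (x.-1)%:R)%R by rewrite /z -{1}(prednK x0) -natr1 addrC.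
have z1 : (z != 1)%R.
  apply: contra nqx => /eqP; rewrite xE -F0 => /(congr1 (fun t => t - 1)%R).
  by rewrite addrC addKr subrr => ->.
have zN k : (z ^+ k = 1 + ((x ^ k).-1)%:R)%R.
  by rewrite /z -natrX -{1}(@prednK (x ^ k)) ?expn_gt0 ?x0 // -natr1 addrC.
have zN1 : (z ^+ N = 1)%R.
  by apply/eqP; rewrite zN -subr_eq0 addrC addKr F0 (dvdn_trans qN).
have [d prd dN] := prim_order_exists N0 zN1.
have d0 := prim_order_gt0 prd.
have cxd : coprime x d by apply: coprime_dvdr dN cxN.
pose m := x ^ totient d.
have zm : (z ^+ m = z)%R.
  by rewrite -(prim_expr_mod prd) Euler_exp_totient // (prim_expr_mod prd) expr1.
have z0 : (z != 0)%R.
  rewrite F0; apply: contraL qN => qx.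
  by rewrite -prime_coprime // (coprime_dvdl qx).
have gd0 : ((gdef x m)%:R = 0 :> 'F_q)%R.
  apply/eqP; have := dvdn_trans qN (dvdT (totient d)).
  by rewrite Euclid_dvdM // Euclid_dvdX // (negbTE nqx) orbF F0.
(* With [gsum_pred] this gives [m * z * (z - 1) = z * (z - 1)] in ['F_q], where [z] and [z - 1]
   cancel. *)
have gs : ((gsum x m)%:R = m%:R * z :> 'F_q)%R.
  have /(congr1 (fun k => (k%:R)%R : 'F_q)) := gsum_gdef m x0.
  by rewrite natrD gd0 addr0 natrM natrX -/z zm.
have /(congr1 (fun k => (k%:R)%R : 'F_q)) := gsum_pred x m.
rewrite !natrM gs -/z => E.
have [xz xm] : (((x.-1)%:R = z - 1) /\ (((x ^ m).-1)%:R = z - 1))%R.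
  by split; [rewrite xE | rewrite -[in RHS]zm zN]; rewrite addrC addKr.
have m1 : (m%:R = 1 :> 'F_q)%R.
  apply/eqP; rewrite -subr_eq0 -(mulIr_eq0 _ (mulIf z0)).
  rewrite -subr_eq0 in z1; rewrite -(mulIr_eq0 _ (mulIf z1)).
  by rewrite -mulrA mulrBl mul1r mulrA -{1}xz E xm subrr.
have : d %| totient d by rewrite (prim_order_dvd prd) /z -natrX m1.
have [d1|d1] := ltnP 1 d; last first.
  have dE : d = 1 by apply/eqP; rewrite eqn_leq d1 d0.
  by case/eqP: z1; rewrite -[z]expr1 -dE prim_expr_order.
by move/dvdn_leq; rewrite totient_gt0 d0 leqNgt totient_lt // => /(_ isT).
Qed.

(** * The key relation *)

Local Open Scope group_scope.

Definition mac_rel (gT : finGroupType) (a b : gT) (x y : nat) :=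
  a ^ [~ a, b] = a ^+ x /\ b ^ [~ b, a] = b ^+ y.

Lemma mac_rel_sym (gT : finGroupType) (a b : gT) x y :
  mac_rel a b x y -> mac_rel b a y x.
Proof. by case. Qed.

Lemma conjgX_exp (gT : finGroupType) (a c : gT) x i k :
  a ^ c = a ^+ x -> (a ^+ i) ^ (c ^+ k) = a ^+ (i * x ^ k).
Proof.
move=> ac; elim: k => [|k IH]; first by rewrite conjg1 muln1.
by rewrite expgSr conjgM IH conjXg ac -expgM expnS mulnCA.
Qed.

Lemma expMg_conj (gT : finGroupType) (a c : gT) x m :
  a ^ c = a ^+ x -> (a * c) ^+ m = c ^+ m * a ^+ gsum x m.
Proof.
move=> ac; elim: m => [|m IH]; first by rewrite /gsum big_ord0 mulg1.
by rewrite (expgSr (a * c)) IH gsumS expgM -ac -conjXg (expgSr c) (expgSr a) conjgE !mulgA mulgK.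
Qed.

Lemma mac_conjX (gT : finGroupType) (a b : gT) x y m :
  mac_rel a b x y -> (a ^+ m) ^ b = [~ a, b] ^+ m * a ^+ gsum x m.
Proof.
by case=> ac _; rewrite conjXg -(expMg_conj _ ac) commgEl mulKVg.
Qed.

(** Write the conjugate as [b * (a ^ b) ^- m * a ^+ m]. Moving [c ^- m] past [a ^+ m] turns the
    latter into [a ^+ (m * x ^ m)], and cancelling [a ^+ gsum x m] leaves the exponent
    [gdef x m]. *)
Lemma mac_conj_expX (gT : finGroupType) (a b : gT) x y m :
  mac_rel a b x y -> 0 < x ->
  b ^ (a ^+ m) = b * a ^+ gdef x m * [~ a, b] ^- m.
Proof.
move=> rab x0; have ab := mac_conjX m rab; have [ac _] := rab.
have -> : b ^ (a ^+ m) = b * (((a ^+ m) ^ b)^-1 * a ^+ m).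
  by rewrite !conjgE !invMg invgK !mulgA mulgV mul1g.
rewrite ab invMg -!mulgA; congr (b * _).
have := conjgX_exp m m ac; rewrite conjgE -(gsum_gdef m x0) expgD => E.
have -> : [~ a, b] ^- m * a ^+ m = a ^+ gsum x m * a ^+ gdef x m * [~ a, b] ^- m.
  by rewrite -E !mulgA mulgK.
by rewrite !mulgA mulVg mul1g.
Qed.

(* Compare two computations of the conjugate of b by a ^ m = a ^ (c ^ j). *)
Lemma mac_key (gT : finGroupType) (a b : gT) x y j :
  mac_rel a b x y -> 0 < x -> 0 < y ->
  let m := (x ^ j)%N in let k := (y ^ j)%N in
  (a ^+ gdef x m) ^ ([~ a, b] ^- (j + k)) =
  b ^- gdef y k * [~ a, b] ^+ m * [~ a, b] ^- k.
Proof.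
move=> rab x0 y0 m k; set c := [~ a, b].
have rba := mac_rel_sym rab; have [ac bc'] := rab.
have c'E : [~ b, a] = c^-1 by rewrite invg_comm.
have am : a ^+ m = a ^ (c ^+ j) by have := conjgX_exp 1 j ac; rewrite expg1 mul1n.
have bX i t : (b ^+ i) ^ (c ^- t) = b ^+ (i * y ^ t).
  by rewrite -expgVn -c'E; apply: conjgX_exp.
(* Both sides equal [(b ^+ k) ^ a], since [a ^+ m = a ^ (c ^+ j)] and [c ^- j] carries [b] to
   [b ^+ k]. *)
have E1 : (b * a ^+ gdef x m * c ^- m) ^ (c ^- j) = c ^- k * b ^+ gsum y k.
  rewrite -(mac_conj_expX m rab x0) am.
  have := mac_conjX k rba; rewrite c'E expgVn => <-.
  have := bX 1%N j; rewrite expg1 mul1n => <-.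
  by rewrite -!conjgM; congr (b ^ _); rewrite !conjgE !mulgA mulgK.
have cc i t : (c ^+ i) ^ (c ^- t) = c ^+ i.
  by apply/conjg_fixP/commgP; rewrite -!expgVn; apply/commuteX2/commuteV.
have E2 : (a ^+ gdef x m) ^ (c ^- j) = b ^- k * c ^- k * b ^+ gsum y k * c ^+ m.
  move: E1; rewrite !conjMg [(c ^- m) ^ _]conjVg cc -[X in b ^ _ * X]expg1.
  have := bX 1%N j; rewrite !expg1 mul1n => ->.
  move: (_ ^ c ^- j) => t /(canRL (mulgKV _)) /(canRL (mulKg _)) ->.
  by rewrite !mulgA.
have cmk : c ^+ m * c ^- k = c ^- k * c ^+ m by apply/commuteV/commuteX2.
(* Conjugating by [c ^- k] turns [b ^- k] into [b ^- (k * y ^ k)], whose part [gsum y k] cancels and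
   leaves [gdef y k]. *)
rewrite addnC expgD invMg conjgM E2 !conjMg !conjVg !cc bX -(gsum_gdef k y0).
rewrite expgD invMg -[RHS]mulgA cmk !mulgA; congr (_ * _).
by rewrite -!mulgA -conjgC mulKg.
Qed.

(** In [mac_key], raising the left side [v] to the power [x.-1] amounts to forming [v ^ c * v^-1].
    On the right the powers of [c] cancel, leaving an element of [<[b]>], which [c] normalises. *)
Lemma mac_cyclic_cap (gT : finGroupType) (a b : gT) x y j :
  mac_rel a b x y -> 0 < x -> 0 < y ->
  a ^+ (gdef x (x ^ j) * x.-1) \in <[b]>.
Proof.
move=> rab x0 y0; have := mac_key j rab x0 y0.
set m := (x ^ j)%N; set k := (y ^ j)%N; set c := [~ a, b]; set T := gdef y k.
set u := a ^+ gdef x m => E.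
have [ac bc'] := rab; rewrite -/c in ac.
have c'E : [~ b, a] = c^-1 by rewrite invg_comm.
have nbc : c \in 'N(<[b]>).
  by rewrite -groupV -c'E -cycle_subG cycle_subG inE -cycleJ bc' cycle_subG mem_cycle.
set t := c ^- (j + k) in E.
have tc : commute t c by apply/commute_sym/commuteV/commuteX.
have nt : t \in 'N(<[b]>) by rewrite groupV groupX.
have uc : u ^ c = u ^+ x by rewrite conjXg ac -!expgM mulnC.
have vc : (u ^ t) ^ c = (u ^ t) ^+ x by rewrite -conjgM tc conjgM uc conjXg.
have ccT : (c ^+ m * c ^- k) ^ c = c ^+ m * c ^- k.
  by apply/conjg_fixP/commgP/commute_sym/commuteM; [|apply: commuteV]; apply: commuteX.
rewrite expgM -/u -(memJ_norm _ nt) conjXg.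
have -> : (u ^ t) ^+ x.-1 = (u ^ t) ^ c * (u ^ t)^-1.
  by rewrite vc -{2}(prednK x0) expgSr mulgK.
rewrite E -[b ^- T * _ * _]mulgA conjMg ccT invMg mulgA mulgK invgK.
by rewrite groupM ?memJ_norm ?groupV // mem_cycle.
Qed.

Lemma cent_gen2 (gT : finGroupType) (a b z : gT) :
  commute a z -> commute b z -> z \in 'C(<<[set a; b]>>).
Proof.
move=> az bz; rewrite cent_gen; apply/centP => t /set2P[]->; exact: commute_sym.
Qed.

Lemma mac_central (gT : finGroupType) (a b : gT) x y j :
  mac_rel a b x y -> 0 < x -> 0 < y ->
  a ^+ (gdef x (x ^ j) * x.-1) \in 'C(<<[set a; b]>>).
Proof.
move=> rab x0 y0; apply: cent_gen2; first exact: commuteX.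
by have /cycleP[i ->] := mac_cyclic_cap j rab x0 y0; apply: commuteX.
Qed.

Lemma comm_in_gen (gT : finGroupType) (a b : gT) : [~ a, b] \in <<[set a; b]>>.
Proof. by rewrite groupR ?mem_gen ?set21 ?set22. Qed.

Lemma mac_commX (gT : finGroupType) (a b : gT) x y i :
  mac_rel a b x y -> 0 < x -> commute (a ^+ i) [~ a, b] -> #[a] %| (i * x.-1)%N.
Proof.
move=> [ac _] x0 /commgP/conjg_fixP; rewrite conjXg ac -expgM => E.
rewrite order_dvdn; apply/eqP/(mulIg (a ^+ i)).
by rewrite -expgD mul1g -mulnSr prednK // mulnC.
Qed.

Lemma mac_order_gdef (gT : finGroupType) (a b : gT) x y j :
  mac_rel a b x y -> 0 < x -> 0 < y ->
  #[a] %| (gdef x (x ^ j) * x.-1 ^ 2)%N.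
Proof.
move=> rab x0 y0; rewrite expnS expn1 mulnA; apply: (mac_commX rab x0).
by have /centP/(_ _ (comm_in_gen a b)) := mac_central j rab x0 y0.
Qed.

(** [a ^+ x] is a conjugate of [a], so it has the same order. *)
Lemma mac_coprime (gT : finGroupType) (a b : gT) x y :
  mac_rel a b x y -> coprime x #[a].
Proof.
move=> [ac _]; have := orderJ a [~ a, b]; rewrite ac orderXgcd => E.
rewrite coprime_sym /coprime; move/eqP: E.
rewrite eq_sym eqn_div ?dvdn_gcdl ?gcdn_gt0 ?order_gt0 //.
by rewrite -{3}[#[a]]muln1 eqn_pmul2l // order_gt0.
Qed.

(** Conjugating [a ^+ #[a] = 1] by [b] makes [a ^+ gsum x #[a]] a power of [c], so it commutes with
    [c] and [#[a]] divides [gsum x #[a] * x.-1 = x * (x ^ #[a]).-1]. *)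
Lemma mac_order_pred (gT : finGroupType) (a b : gT) x y :
  mac_rel a b x y -> 0 < x -> #[a] %| (x ^ #[a]).-1.
Proof.
move=> rab x0; have := mac_conjX #[a] rab; rewrite expg_order conj1g => E.
rewrite -(Gauss_dvdr _ (n := x)) 1?coprime_sym ?(mac_coprime rab) // -gsum_pred.
apply: (mac_commX rab x0).
have -> : a ^+ gsum x #[a] = [~ a, b] ^- #[a] by rewrite -[RHS]mulg1 E mulKg.
exact/commute_sym/commuteV/commuteX.
Qed.

Lemma mac_prime_pred (gT : finGroupType) (a b : gT) x y q :
  mac_rel a b x y -> 0 < x -> 0 < y -> prime q -> q %| #[a] -> q %| x.-1.
Proof.
move=> rab x0 y0 qp qa; apply: (@prime_dvd_pred _ _ #[a]) => //.
- exact: mac_coprime rab.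
- exact: mac_order_pred rab x0.
- by move=> j; apply: mac_order_gdef rab x0 y0.
Qed.

(** * Nilpotency *)

Local Open Scope nat_scope.

(** Bezout writes some [kn * q.-1 + 1] as a multiple of [M]. Raising [w] to that exponent gives [w]
    by Fermat and 1 by hypothesis. *)
Lemma modn_root_coprime q w M : prime q -> 0 < M -> coprime M q.-1 ->
  w ^ M = 1 %[mod q] -> w = 1 %[mod q].
Proof.
move=> qp M0 /eqP cMq wM; case: (egcdnP q.-1 M0) => km kn def_g _.
have wk k : w ^ (k * q.-1 + 1) = w %[mod q].
  elim: k => [|k IH]; first by rewrite expn1.
  have -> : k.+1 * q.-1 + 1 = k * q.-1 + q by have := prime_gt0 qp; nia.
  by rewrite expnD -modnMmr fermat_little // modnMmr -expnSr -addn1.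
have E : kn * q.-1 + 1 = km * M by rewrite def_g cMq.
by rewrite -(wk kn) E mulnC expnM -modnXm wM modnXm exp1n.
Qed.

Lemma logn_dvdn_prime q k o : prime q -> 0 < k -> o %| q * k -> ~~ (o %| k) ->
  logn q k < logn q o.
Proof.
move=> qp k0 oqk; apply: contraR; rewrite -leqNgt => le_ok.
have o0 : 0 < o by apply: dvdn_gt0 oqk; rewrite muln_gt0 prime_gt0.
rewrite -(partnC q o0) Gauss_dvd ?coprime_partC //; apply/andP; split.
  by rewrite p_part pfactor_dvdn.
rewrite -(@Gauss_dvdr _ q).
  by apply: dvdn_trans oqk; apply: dvdn_part.
by rewrite coprime_sym prime_coprime // -p'natE // part_pnat.
Qed.

Local Open Scope group_scope.

(** Every prime divisor of [#[a]] divides [x.-1], so [#[a]] divides [gsum x #[a]]; conjugating [a ^+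
    #[a] = 1] by [b] then leaves only [c ^+ #[a]]. *)
Lemma mac_order_comm (gT : finGroupType) (a b : gT) x y :
  mac_rel a b x y -> 0 < x -> 0 < y -> #[[~ a, b]] %| #[a].
Proof.
move=> rab x0 y0; rewrite order_dvdn; apply/eqP.
have as1 : a ^+ gsum x #[a] = 1.
  apply/eqP; rewrite -order_dvdn gsum_geom dvdn_mull // dvdn_geom //.
  by move=> p; apply: (mac_prime_pred rab).
by have := mac_conjX #[a] rab; rewrite expg_order conj1g as1 mulg1.
Qed.

(** [(x ^ m).-1] is [x.-1], a multiple of [q], times a geometric sum divisible by [#[a] %/ q]; hence
    [c ^+ m] fixes [a]. *)
Lemma mac_commX_comm (gT : finGroupType) (a b : gT) x y q m :
  mac_rel a b x y -> 0 < x -> 0 < y -> prime q -> q %| #[a] ->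
  #[a] %/ q %| m -> commute a ([~ a, b] ^+ m).
Proof.
move=> rab x0 y0 qp qa am; have [ac _] := rab.
apply/commgP/conjg_fixP; have := conjgX_exp 1 m ac; rewrite expg1 mul1n => ->.
rewrite -{2}[a]expg1; apply/eqP; rewrite eq_expg_mod_order eqn_mod_dvd ?expn_gt0 ?x0 //.
rewrite subn1 predn_exp -(divnK qa) mulnC dvdn_mul //.
  exact: (mac_prime_pred rab x0 y0).
apply: dvdn_geom_mul => // [|p pp pa]; first by rewrite divn_gt0 ?prime_gt0 // dvdn_leq.
by apply: (mac_prime_pred rab) pp _ => //; rewrite -(divnK qa) dvdn_mulr.
Qed.

(* b acts on the subgroup of order q as an exponent w with w ^ #[b] = 1 modulo q,
   so w = 1. *)
Lemma mac_socle_central (gT : finGroupType) (a b : gT) x y q :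
  mac_rel a b x y -> 0 < x -> 0 < y -> prime q -> q %| #[a] ->
  coprime #[b] q.-1 -> [~ a, b] ^+ (#[a] %/ q) = 1 ->
  a ^+ (#[a] %/ q) \in 'C(<<[set a; b]>>).
Proof.
move=> rab x0 y0 qp qa cbq cq; set m := (#[a] %/ q)%N; set u := a ^+ m.
have m0 : 0 < m by rewrite divn_gt0 ?prime_gt0 // dvdn_leq.
have ou : #[u] = q.
  by rewrite /u orderXdiv ?dvdn_div // -{1}(divnK qa) mulKn.
have /dvdnP[w def_w] : m %| gsum x m.
  rewrite gsum_geom dvdn_mull // dvdn_geom // => p pp pm.
  by apply: (mac_prime_pred rab) pp _ => //; rewrite -(divnK qa) dvdn_mulr.
have ub : u ^ b = u ^+ w by rewrite (mac_conjX m rab) cq mul1g def_w mulnC expgM.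
have w1 : w = 1 %[mod q].
  apply: modn_root_coprime cbq _ => //.
  have := conjgX_exp 1 #[b] ub; rewrite expg_order conjg1 expg1 mul1n -{1}[u]expg1.
  by move/eqP; rewrite eq_expg_mod_order ou => /eqP.
apply: cent_gen2; first exact: commuteX.
apply/commute_sym/commgP/conjg_fixP; rewrite ub -[RHS]expg1.
by apply/eqP; rewrite eq_expg_mod_order ou w1.
Qed.

Lemma expg_div_neq1 (gT : finGroupType) (a : gT) q :
  prime q -> q %| #[a] -> a ^+ (#[a] %/ q) != 1.
Proof.
move=> qp qa; rewrite -order_dvdn; apply/negP => /dvdn_leq.
rewrite divn_gt0 ?prime_gt0 // dvdn_leq // => /(_ isT).
by rewrite leqNgt ltn_Pdiv ?prime_gt1.
Qed.

Lemma mac_center_neq1 (gT : finGroupType) (a b : gT) x y :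
  mac_rel a b x y -> 0 < x -> 0 < y ->
  <<[set a; b]>> != 1 -> 'Z(<<[set a; b]>>) != 1.
Proof.
move=> rab x0 y0; apply: contra_neq => Z1; have rba := mac_rel_sym rab.
set G := <<_>> in Z1 *; set c := [~ a, b].
have c'E : [~ b, a] = c^-1 by rewrite invg_comm.
have oc' : #[[~ b, a]] = #[c] by rewrite c'E orderV.
have hz z : z \in G -> z \in 'C(G) -> z = 1.
  by move=> zG zC; apply/set1P; rewrite -[[set 1]]/(1 : {set gT}) -Z1 inE zG.
have aG : a \in G by rewrite mem_gen ?set21.
have bG : b \in G by rewrite mem_gen ?set22.
have oca := mac_order_comm rab x0 y0; rewrite -/c in oca.
have ocb := mac_order_comm rba y0 x0; rewrite oc' in ocb.
(* Otherwise the subgroup of order [q] in [<[a]>] would be central, against the trivial centre. *)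
have na q : prime q -> q %| #[a] -> coprime #[b] q.-1 -> ~~ (#[c] %| #[a] %/ q).
  move=> qp qa cbq; rewrite order_dvdn; apply/eqP => cq.
  have := mac_socle_central rab x0 y0 qp qa cbq cq => /hz.
  by rewrite groupX // => /(_ isT)/eqP; apply/negP/expg_div_neq1.
have nb q : prime q -> q %| #[b] -> coprime #[a] q.-1 -> ~~ (#[c] %| #[b] %/ q).
  move=> qp qb caq; rewrite -oc' order_dvdn; apply/eqP => cq.
  have := mac_socle_central rba y0 x0 qp qb caq cq; rewrite [[set b; a]]setUC => /hz.
  by rewrite groupX // => /(_ isT)/eqP; apply/negP/expg_div_neq1.
have [le1|gt1] := leqP (#[a] * #[b]) 1.
  have [a1 b1] : a = 1 /\ b = 1.
    by split; apply/eqP; rewrite -order_eq1; have := order_gt0 a; have := order_gt0 b; nia.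
  by rewrite /G a1 b1 setUid; apply: cycle1.
pose q := pdiv (#[a] * #[b]); have qp : prime q by apply: pdiv_prime.
(* A nontrivial gcd would divide [#[a] * #[b]] and lie below its least prime divisor [q]. *)
have cop k : k %| (#[a] * #[b])%N -> coprime k q.-1.
  move=> kd; rewrite /coprime eqn_leq gcdn_gt0 andbC.
  have q1 := prime_gt1 qp; have -> /= : (0 < k) || (0 < q.-1) by apply/orP; right; lia.
  rewrite leqNgt; apply/negP => g1.
  have := pdiv_min_dvd g1 (dvdn_trans (dvdn_gcdl _ _) kd); rewrite -/q.
  have := dvdn_leq _ (dvdn_gcdr k q.-1); lia.
have copa := cop _ (dvdn_mulr #[b] (dvdnn #[a])).
have copb := cop _ (dvdn_mull #[a] (dvdnn #[b])).
have divo N : q %| N -> #[c] %| N -> ~~ (#[c] %| N %/ q) -> q %| #[c].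
  move=> qN cN; apply: contraR => qc.
  by rewrite -(@Gauss_dvdr _ q) ?[(q * _)%N]mulnC ?divnK // coprime_sym prime_coprime.
have qc : q %| #[c].
  have : q %| #[a] * #[b] by apply: pdiv_dvd.
  rewrite Euclid_dvdM // => /orP[qa|qb].
    exact: divo qa oca (na q qp qa copb).
  exact: divo qb ocb (nb q qp qb copa).
have qa := dvdn_trans qc oca; have qb := dvdn_trans qc ocb.
pose m := lcmn (#[a] %/ q) (#[b] %/ q).
have qa0 : 0 < #[a] %/ q by rewrite divn_gt0 ?prime_gt0 // dvdn_leq.
have qb0 : 0 < #[b] %/ q by rewrite divn_gt0 ?prime_gt0 // dvdn_leq.
have cm1 : c ^+ m = 1.
  apply: hz; first by rewrite groupX ?groupR.
  apply: cent_gen2; first by apply: (mac_commX_comm rab x0 y0 qp qa (dvdn_lcml _ _)).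
  have := mac_commX_comm rba y0 x0 qp qb (dvdn_lcmr (#[a] %/ q) _).
  by rewrite c'E expgVn => /commuteV; rewrite invgK.
(* [#[c]] divides the lcm [m], yet its [q]-adic valuation exceeds those of both [#[a] %/ q] and
   [#[b] %/ q]. *)
have := dvdn_leq_log q; have : #[c] %| m by rewrite order_dvdn cm1.
move=> cm /(_ _ _ _ cm); rewrite lcmn_gt0 qa0 qb0 => /(_ isT).
rewrite logn_lcm // leqNgt gtn_max !logn_dvdn_prime //.
- by rewrite mulnC divnK.
- exact: nb.
- by rewrite mulnC divnK.
- exact: na.
Qed.

Lemma mac_nilpotent (gT : finGroupType) (a b : gT) x y :
  mac_rel a b x y -> 0 < x -> 0 < y -> nilpotent <<[set a; b]>>.
Proof.
move=> + x0 y0; have [n] := ubnP #|<<[set a; b]>>|.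
elim: n => // n IH in gT a b * => leGn rab.
have [->|G1] := eqVneq <<[set a; b]>> 1; first exact: nilpotent1.
have Z1 := mac_center_neq1 rab x0 y0 G1.
set G := <<[set a; b]>>%G; rewrite -[<<_>>]/(G : {set gT}) -quotient_center_nil.
have nZ : [set a; b] \subset 'N('Z(G)).
  by apply: subset_trans (normal_norm (center_normal G)); apply: subset_gen.
have [aN bN] : a \in 'N('Z(G)) /\ b \in 'N('Z(G)).
  by split; apply: (subsetP nZ); rewrite ?set21 ?set22.
have GZ : G / 'Z(G) = <<[set coset 'Z(G) a; coset 'Z(G) b]>>.
  by rewrite quotient_gen // quotientE morphimU !morphim_set1.
rewrite GZ; apply: IH.
  by rewrite ltnS in leGn; rewrite -GZ; apply: leq_trans leGn; rewrite ltn_quotient ?center_sub.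
have [ac bc] := rab; split.
  by rewrite -morphR // -morphJ ?groupR // ac morphX.
by rewrite -morphR // -morphJ ?groupR // bc morphX.
Qed.

(** * Relations in the 2-part *)

Local Open Scope nat_scope.

Lemma gdef_bin r m : 0 < r -> exists k, gdef r m = r.-1 * ('C(m, 2) + r.-1 * k).
Proof.
move=> r0; exists (\sum_(i < m) i * \sum_(j < i) r ^ j); rewrite /gdef; congr (_ * _).
rewrite -bin2_sum big_mkord big_distrr -big_split; apply: eq_bigr => i _ /=.
by rewrite -{1}[r ^ i]prednK ?expn_gt0 ?r0 // predn_exp mulnS mulnCA.
Qed.

(** The odd last factor shows the exact 2-adic valuation of the exponents in [mac_key] for
    [j = 1]. *)
Lemma gdef_diag h : exists k, gdef h.*2.+1 h.*2.+1 = 2 * h ^ 2 * k.*2.+1.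
Proof.
have [k ->] := @gdef_bin h.*2.+1 h.*2.+1 isT; exists (h + k).
by rewrite bin2 succnK -doubleMr doubleK -!mul2n -[(2 * h).+1]addn1 -[(2 * (h + k)).+1]addn1; ring.
Qed.

Lemma logn2_odd r : 0 < r -> exists2 u, odd u & r = 2 ^ logn 2 r * u.
Proof.
move=> r0; have [u ou {1}->] := pfactor_coprime (isT : prime 2) r0.
by exists u; [rewrite -coprime2n | rewrite mulnC].
Qed.

Local Open Scope group_scope.

Lemma two_elt_odd (gT : finGroupType) (z : gT) k :
  2.-elt z -> odd k -> z ^+ k = 1 -> z = 1.
Proof.
move=> z2 ok /eqP; rewrite -order_dvdn => zk; apply/eqP; rewrite -order_eq1.
have ck : coprime #[z] k by rewrite (pnat_coprime z2) // p'natE // dvdn2 ok.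
by rewrite -dvdn1 -(eqP ck) dvdn_gcd dvdnn.
Qed.

Lemma two_elt_expg_parity (gT : finGroupType) (z : gT) i j :
  2.-elt z -> odd i -> ~~ odd j -> z ^+ i = z ^+ j -> z = 1.
Proof.
move=> z2 oi oj E; have [ij|/ltnW ji] := leqP i j.
  apply: (@two_elt_odd _ z (j - i)) => //; first by rewrite oddB // oi (negbTE oj).
  by apply: (mulgI (z ^+ i)); rewrite -expgD subnKC // E mulg1.
apply: (@two_elt_odd _ z (i - j)) => //; first by rewrite oddB // oi (negbTE oj).
by apply: (mulgI (z ^+ j)); rewrite -expgD subnKC // E mulg1.
Qed.

Lemma mac2_relations (gT : finGroupType) (a b : gT) x y n :
  mac_rel a b x y -> 0 < x -> 0 < y -> 2.-elt a -> 2.-elt b ->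
  x != 1%N -> y != 1%N -> logn 2 x.-1 = 1%N -> logn 2 y.-1 = n -> 2 < n ->
  [/\ a ^+ 4 = 1, [~ a, b] ^+ 2 = a ^+ 2, commute b (a ^+ 2)
    & b ^+ (2 ^ n.+1) = 1].
Proof.
move=> rab x0 y0 a2 b2 x1 y1 vx vy n2; have rba := mac_rel_sym rab.
have [ac bc'] := rab; set c := [~ a, b] in ac *.
have c'E : [~ b, a] = c^-1 by rewrite invg_comm.
have xp0 : 0 < x.-1 by rewrite -ltnS prednK // ltn_neqAle eq_sym x1.
have yp0 : 0 < y.-1 by rewrite -ltnS prednK // ltn_neqAle eq_sym y1.
have [h oh def_x] : exists2 h, odd h & x = h.*2.+1.
  have [h oh E] := logn2_odd xp0; exists h => //.
  by rewrite -(prednK x0) E vx expn1 mul2n.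
have [u ou def_y] : exists2 u, odd u & y = (2 ^ n.-1 * u).*2.+1.
  have [u ou E] := logn2_odd yp0; exists u => //.
  by rewrite -(prednK y0) E vy -{1}(ltn_predK n2) expnS -mulnA mul2n.
set g := (2 ^ n.-1 * u)%N in def_y.
have [k1 def_T] := gdef_diag h; have [k2 def_T'] := gdef_diag g.
rewrite -def_x in def_T; rewrite -def_y in def_T'.
have eg : ~~ odd g.
  by rewrite oddM oddX orbF; case: (n) n2 => [|[|?]].
have dvd_a j : a ^+ (2 ^ j * (h ^ 2 * k1.*2.+1 * h ^ j.-1)) = 1 -> a ^+ (2 ^ j) = 1.
  rewrite expgM => E; apply: two_elt_odd E; first exact: p_eltX.
  by rewrite !oddM !oddX oh /= odd_double /= !orbT.
(* [#[a]] divides [gdef x x * x.-1 ^ 2], which is 8 times an odd number. *)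
have a8 : a ^+ 8 = 1.
  apply: (dvd_a 3); apply/eqP; rewrite -order_dvdn.
  have := mac_order_gdef 1 rab x0 y0; rewrite expn1 def_T; congr (_ %| _).
  by rewrite def_x /=; lia.
(* The square of the odd number [x] is 1 modulo 8. *)
have ca2 i : commute a (c ^+ i.*2).
  apply/commgP/conjg_fixP; have := conjgX_exp 1 i.*2 ac; rewrite expg1 mul1n => ->.
  rewrite -{2}[a]expg1; apply/eqP; rewrite eq_expg_mod_order eqn_mod_dvd ?expn_gt0 ?x0 //.
  apply: (@dvdn_trans 8); first by rewrite order_dvdn a8.
  rewrite -mul2n expnM subn1; apply: dvdn_trans (dvdn_pred_predX _ _).
  have -> : (x ^ 2).-1 = (4 * (h * h.+1))%N by rewrite def_x; nia.
  by rewrite -[8]/(4 * 2)%N dvdn_pmul2l // dvdn2 oddM /= oh.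
have cxy : c ^+ x * c ^- y = c ^+ h.*2 * c ^- g.*2.
  by rewrite def_x def_y (expgSr c h.*2) (expgSr c g.*2) invMg -mulgA mulKVg.
have key := mac_key 1 rab x0 y0; rewrite /= !expn1 -/c -mulgA cxy in key.
set t := c ^- (1 + y) in key; set T := gdef x x in key def_T; set T' := gdef y y in key def_T'.
have cca i k : commute a (c ^+ i.*2 * c ^- k.*2).
  by apply: commuteM; [|apply: commuteV]; apply: ca2.
have def_bT : b ^+ T' = c ^+ h.*2 * c ^- g.*2 * ((a ^+ T) ^ t)^-1.
  by rewrite key invMg invgK mulKVg.
have nac : c \in 'N(<[a]>).
  by rewrite -cycle_subG cycle_subG inE -cycleJ ac cycle_subG mem_cycle.
have aT_a : commute a ((a ^+ T) ^ t).
  have : (a ^+ T) ^ t \in <[a]> by rewrite memJ_norm ?mem_cycle // groupV groupX.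
  by case/cycleP=> i ->; apply: commuteX.
(* [b ^+ T'] is a product of even powers of [c] and a power of [a]; commuting with [a] makes it
   central. *)
have bT_a : commute a (b ^+ T') by rewrite def_bT; apply: commuteM (cca _ _) (commuteV aT_a).
have bT_c : commute (b ^+ T') c.
  have bT_C : b ^+ T' \in 'C(<<[set a; b]>>) by apply: cent_gen2 => //; apply: commuteX.
  exact: (centP bT_C _ (comm_in_gen a b)).
have tc : commute t c by apply/commute_sym/commuteV/commuteX.
have vc : commute ((a ^+ T) ^ t) c.
  rewrite key; apply/commute_sym/commuteM; first exact/commuteV/commute_sym.
  by apply: commuteM; [|apply: commuteV]; apply: commuteX.
(* The right side of [key] commutes with [c], and so does [t]. Hence [#[a]] divides [T * x.-1],
   which is 4 times an odd number. *)
have aT_c : commute (a ^+ T) c.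
  apply/commgP/conjg_fixP/(conjg_inj t); rewrite -conjgM -tc conjgM.
  exact/conjg_fixP/commgP.
have a4 : a ^+ 4 = 1.
  apply: (dvd_a 2); apply/eqP; rewrite -order_dvdn.
  have := mac_commX rab x0 aT_c; rewrite def_T; congr (_ %| _).
  by rewrite def_x succnK; move: (k1.*2.+1) => k'; rewrite -mul2n -[2.-1]/1%N; ring.
have z2 (z : gT) w : z ^+ 4 = 1 -> odd w -> z ^+ (2 * w) = z ^+ 2.
  move=> z4 ow; rewrite -(odd_double_half w) ow mulnDr expgD -mul2n mulnA [z ^+ (2 * 2 * _)]expgM.
  by rewrite (z4 : z ^+ (2 * 2) = 1) expg1n mulg1 muln1.
have aT2 : a ^+ T = a ^+ 2.
  by rewrite def_T -mulnA z2 // oddM oddX oh /= odd_double.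
have c4 : c ^+ 4 = 1.
  apply/eqP; rewrite -order_dvdn; apply: dvdn_trans (mac_order_comm rab x0 y0) _.
  by rewrite order_dvdn a4.
have cg : c ^+ g.*2 = 1.
  rewrite -[g]odd_double_half (negbTE eg) add0n -!mul2n mulnA expgM.
  by rewrite (c4 : c ^+ (2 * 2) = 1) expg1n.
have a2E : a ^+ 2 = b ^- T' * c ^+ 2.
  have <- : (a ^+ T) ^ t = a ^+ 2.
    rewrite -aT2; apply/conjg_fixP/commgP/commuteV; exact: commuteX.
  by rewrite key cg invg1 mulg1 -mul2n z2.
have a2b : (a ^+ 2) ^ b = c ^+ 2.
  rewrite (mac_conjX 2 rab) -/c.
  (* This is [x * x.+1], a multiple of 4 since [h] is odd. *)
  have -> : gsum x 2 = (4 * (h.*2.+1 * h.+1./2))%N.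
    rewrite !gsumSr /gsum big_ord0 add0n expn1 def_x.
    have -> : h = (h./2).*2.+1 by rewrite -{1}(odd_double_half h) oh.
    move: (h./2) => k; rewrite [k.*2.+1.+1./2]/= doubleK; lia.
  by rewrite expgM a4 expg1n mulg1.
have c2b : (c ^+ 2) ^ b = b^-1 * b ^+ (y ^ 2) * c ^+ 2.
  have := conjgX_exp 1 2 bc'; rewrite expg1 mul1n => <-.
  by rewrite c'E expgVn -[RHS]mulgA -conjgCV conjgE.
(* Conjugate [a2E] by [b]: its left side becomes [c ^+ 2], and [c2b] computes its right side. *)
have : b ^+ (y ^ 2).-1 = b ^+ T'.
  apply: (mulgI b); rewrite -expgS prednK ?expn_gt0 ?y0 //.
  apply: (mulIg (c ^+ 2)); rewrite -[in RHS]mulgA.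
  have: c ^+ 2 = b ^- T' * (b^-1 * b ^+ (y ^ 2) * c ^+ 2).
    rewrite -c2b -[LHS]a2b [in LHS]a2E conjMg; congr (_ * _).
    by apply/conjg_fixP/commgP/commute_sym/commuteV/commuteX.
  move=> {2}->; rewrite mulKVg -!mulgA mulKVg //.
set e := (u * u * (k2.*2.+1) * 2 ^ n.-2)%N.
have p1 : (2 ^ n.+1 = 4 * 2 ^ n.-1)%N by rewrite -{1}(ltn_predK n2) !expnS mulnA.
have p2 : (2 ^ n.-1 = 2 * 2 ^ n.-2)%N by rewrite -expnS; case: (n) n2 => [|[|?]].
have -> : (y ^ 2).-1 = (2 ^ n.+1 * (u * g.+1))%N.
  rewrite mulnA p1 -[(4 * _ * u)%N]mulnA -/g def_y; move: (g) => k; clear; nia.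
have T'E : T' = (2 ^ n.+1 * e)%N.
  rewrite def_T' p1 /e /g p2; move: (2 ^ n.-2)%N (k2.*2.+1) => w k'; ring.
(* Once [2 ^ n.+1] is factored out, the cofactor [u * g.+1] is odd while [e] is even because
   [2 < n]. *)
rewrite T'E !(expgM b) => /two_elt_expg_parity E.
have b0 : b ^+ (2 ^ n.+1) = 1.
  apply: E; first exact: p_eltX.
    by rewrite oddM ou /= (negbTE eg).
  by rewrite /e oddM oddX; case: (n) n2 => [|[|[|?]]] //; rewrite andbF.
have ca : c ^+ 2 = a ^+ 2 by rewrite a2E T'E expgM b0 expg1n invg1 mul1g.
by split=> //; apply/commute_sym/commgP/conjg_fixP; rewrite a2b.
Qed.

(** * Order and class of the 2-part *)

Local Open Scope group_scope.

Lemma leq_card_mulG (gT : finGroupType) (H K : {group gT}) : #|H * K| <= (#|H| * #|K|)%N.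
Proof. by rewrite mul_cardG leq_pmulr ?cardG_gt0. Qed.

(** The intersection of the two cyclic groups contains [<[c ^+ 2]>], of index at most 2 in
    [<[c]>]. *)
Lemma card_cycle_mul_sqr (gT : finGroupType) (a c : gT) :
  c ^+ 2 \in <[a]> -> #|<[a]> * <[c]>| <= (2 * #[a])%N.
Proof.
move=> ca; rewrite -(leq_pmul2r (cardG_gt0 (<[a]> :&: <[c]>))) -mul_cardG.
rewrite [(2 * _)%N]mulnC -mulnA leq_pmul2l ?order_gt0 //.
have sub : <[c ^+ 2]> \subset <[a]> :&: <[c]>.
  by rewrite subsetI !cycle_subG ca mem_cycle.
apply: leq_trans (leq_mul (leqnn 2) (subset_leq_card sub)); rewrite -!orderE orderXgcd.
rewrite -{1}(divnK (dvdn_gcdl #[c] 2)) mulnC; apply: leq_mul => //.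
by rewrite dvdn_leq // dvdn_gcdr.
Qed.

Lemma mac2_bounds (gT : finGroupType) (a b : gT) x y n :
  mac_rel a b x y -> 0 < x -> 0 < y -> 2.-elt a -> 2.-elt b ->
  x != 1%N -> y != 1%N -> logn 2 x.-1 = 1%N -> logn 2 y.-1 = n -> 2 < n ->
  #|<<[set a; b]>>| <= (2 * #[a] * #[b])%N /\ nil_class <<[set a; b]>> <= 3.
Proof.
move=> rab x0 y0 a2 b2 x1 y1 vx vy n2.
have [a4 ca ba2 b0] := mac2_relations rab x0 y0 a2 b2 x1 y1 vx vy n2.
have [ac bc'] := rab; set c := [~ a, b] in ac ca *.
have c'E : [~ b, a] = c^-1 by rewrite invg_comm.
have xp0 : 0 < x.-1 by rewrite -ltnS prednK // ltn_neqAle eq_sym x1.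
have yp0 : 0 < y.-1 by rewrite -ltnS prednK // ltn_neqAle eq_sym y1.
have [h oh def_x] := logn2_odd xp0; have [u ou def_y] := logn2_odd yp0.
rewrite vx in def_x; rewrite vy in def_y.
have xE := prednK x0; have yE := prednK y0.
have aX : a ^+ x.-1 = a ^+ 2.
  rewrite def_x -(odd_double_half h) oh mulnDr expgD -mul2n expn1 mulnA.
  by rewrite [a ^+ (2 * 2 * _)]expgM (a4 : a ^+ (2 * 2) = 1) expg1n mulg1 muln1.
set z := b ^+ (2 ^ n).
have z2 : z ^+ 2 = 1 by rewrite -expgM -expnSr.
have bY : b ^+ y.-1 = z.
  by rewrite def_y expgM -/z -(odd_double_half u) ou -mul2n expgD expgM z2 expg1n mulg1.
have a2C : a ^+ 2 \in 'C(<<[set a; b]>>) by apply: cent_gen2; first exact: commuteX.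
have ac2 : a ^ c = a * a ^+ 2 by rewrite ac -xE expgS aX.
have bc : b ^ c^-1 = b * z by rewrite -c'E bc' -yE expgS bY.
have zc : commute z c.
  rewrite -[c]invgK; apply/commuteV/commgP/conjg_fixP.
  rewrite /z conjXg bc expgMn; last exact: commuteX.
  by rewrite -/z -[X in z ^+ (2 ^ X)](ltn_predK n2) expnS expgM z2 expg1n mulg1.
have cb : c ^ b = z * c.
  apply: (mulgI b); rewrite -conjgC mulgA -bc.
  exact: conjgCV.
have c_a : c ^ a = c^-1.
  apply: (mulgI a); rewrite -conjgC; apply: (mulIg (c ^+ 2)).
  have -> : a * c^-1 * c ^+ 2 = a * c by rewrite -mulgA expgS mulKg.
  by rewrite [RHS]conjgC ac2 -ca [RHS]mulgA.
have zC : z \in 'C(<<[set a; b]>>).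
  apply: cent_gen2; last exact: commuteX.
  apply/commute_sym/commgP/conjg_fixP.
  (* Conjugating [c ^ b = z * c] by [a], with [c ^ a = c^-1] and [b ^ a = b * c^-1], gives
     [z ^ a = z^-1 = z]. *)
  have := congr1 (conjg^~ a) cb; rewrite -[LHS]conjgM [b * a]conjgC conjgM c_a.
  have -> : b ^ a = b * c^-1 by rewrite -c'E commgEl mulKVg.
  rewrite conjgM conjVg cb conjMg c_a => E.
  have zc' : z ^ c^-1 = z by apply/conjg_fixP/commgP/commuteV.
  have cc' : c ^ c^-1 = c by rewrite conjgE invgK mulgV mulg1.
  move: E; rewrite conjVg conjMg zc' cc' zc invMg.
  by move/mulIg <-; apply/eqP; rewrite eq_invg_mul -expg2 z2.
have aP : a \in <<[set a; b]>> by rewrite mem_gen ?set21.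
have bP : b \in <<[set a; b]>> by rewrite mem_gen ?set22.
have cP : c \in <<[set a; b]>> by rewrite groupR.
have zP : z \in <<[set a; b]>> by rewrite groupX.
split.
  (* Adjoining [z] makes [N] stable under [b], as [c ^ b = z * c]. The group is then [N * <[b]> = K
     * <[b]>], since [z] is a power of [b]. *)
  set K := <[a]> <*> <[c]>; set N := K <*> <[z]>.
  have KP : K \subset <<[set a; b]>> by rewrite join_subG !cycle_subG aP.
  have KE : K = <[a]> * <[c]>.
    by rewrite /K norm_joinEr // cycle_subG inE -cycleJ ac cycle_subG mem_cycle.
  have NE : N = K * <[z]>.
    by rewrite /N norm_joinEr // cents_norm // cycle_subG (subsetP (centS KP)).
  have aK : a \in K by rewrite mem_gen // inE cycle_id.
  have cK : c \in K by rewrite mem_gen // inE cycle_id orbT.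
  have zN : z \in N by rewrite mem_gen // inE cycle_id orbT.
  have KN : K \subset N by apply: joing_subl.
  have nNb : <[b]> \subset 'N(N).
    rewrite cycle_subG inE /N /K !conjYg -!cycleJ !join_subG !cycle_subG -/K -/N.
    have -> : a ^ b = a * c by rewrite /c commgEl mulKVg.
    have -> : z ^ b = z by apply/conjg_fixP/commgP/commute_sym/commuteX.
    by rewrite cb zN andbT; apply/andP; split; apply: groupM => //; apply: (subsetP KN).
  have PE : <<[set a; b]>> = N <*> <[b]>.
    apply/eqP; rewrite eqEsubset; apply/andP; split; last first.
      by rewrite !join_subG !cycle_subG aP cP zP bP.
    rewrite gen_subG subUset !sub1set; apply/andP; split.
      exact: (subsetP (joing_subl _ _)) _ (subsetP KN _ aK).
    exact: (subsetP (joing_subr _ _)) _ (cycle_id b).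
  rewrite PE norm_joinEr //= -/N NE -mulgA mulSGid ?cycle_subG ?mem_cycle //.
  apply: leq_trans (leq_card_mulG _ _) _; rewrite -orderE leq_pmul2r ?order_gt0 //.
  by rewrite /= -/K KE; apply: card_cycle_mul_sqr; rewrite ca mem_cycle.
have nilP := mac_nilpotent rab x0 y0; pose P := <<[set a; b]>>%G.
rewrite -[<<_>>]/(gval P) in a2C zC aP bP cP zP nilP *.
have nZ t : t \in P -> t \in 'N('Z(P)) by apply: subsetP; rewrite normal_norm ?center_normal.
have cosC s t : s \in P -> t \in P -> [~ s, t] \in 'Z(P) ->
    commute (coset 'Z(P) s) (coset 'Z(P) t).
  by move=> sP tP sZ; apply/commgP; rewrite -morphR ?nZ //= coset_id.
have a2Z : a ^+ 2 \in 'Z(P) by rewrite inE groupX.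
have zZ : z \in 'Z(P) by rewrite inE zP.
(* [[~ a, c] = a ^+ 2] and [[~ c, b] = z] are central, so [c] is central modulo the centre. *)
have acC : commute (coset 'Z(P) a) (coset 'Z(P) c).
  by apply: cosC => //; rewrite commgEl ac2 mulKg.
have bcC : commute (coset 'Z(P) b) (coset 'Z(P) c).
  apply/commute_sym/cosC => //; rewrite commgEl cb zc mulKg //.
have Q2 : nil_class (P / 'Z(P)) <= 2.
  have PQ : P / 'Z(P) = <[coset 'Z(P) a]> <*> <[coset 'Z(P) b]>.
    rewrite /P /= quotient_gen; last by apply/subsetP=> t /set2P[]->; apply: nZ.
    rewrite quotientE morphimU !morphim_set1 ?nZ // joing_idl joing_idr //.
  have cQ : [~ coset 'Z(P) a, coset 'Z(P) b] = coset 'Z(P) c by rewrite morphR ?nZ.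
  have cC : [~ coset 'Z(P) a, coset 'Z(P) b] \in 'C(<[coset 'Z(P) a]> <*> <[coset 'Z(P) b]>).
    by rewrite cQ joing_idl joing_idr cent_gen2.
  rewrite nil_class2 /= -/P PQ (der1_joing_cycles cC) cycle_subG.
  have cPQ : coset 'Z(P) c \in P / 'Z(P) by apply: mem_quotient.
  by apply/setIP; split=> //; rewrite cQ; rewrite PQ in cPQ.
by move: Q2; rewrite nil_class_quotient_center // -subn1 leq_subLR.
Qed.

Lemma mac2_structure (gT : finGroupType) (a b : gT) x y n :
  mac_rel a b x y -> 0 < x -> 0 < y -> 2.-elt a -> 2.-elt b ->
  x != 1%N -> y != 1%N -> logn 2 x.-1 = 1%N -> logn 2 y.-1 = n -> 2 < n ->
  (2 ^ (n + 4) <= #|<<[set a; b]>>|)%N ->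
  [/\ #|<<[set a; b]>>| = (2 ^ (n + 4))%N, nil_class <<[set a; b]>> = 3,
      #[a] = 4%N, #[[~ a, b]] = 4%N & #[b] = (2 ^ n.+1)%N].
Proof.
move=> rab x0 y0 a2 b2 x1 y1 vx vy n2 ge_P.
have [a4 ca _ b0] := mac2_relations rab x0 y0 a2 b2 x1 y1 vx vy n2.
have [le_P nilP] := mac2_bounds rab x0 y0 a2 b2 x1 y1 vx vy n2.
have oa : #[a] <= 4 by rewrite dvdn_leq // order_dvdn a4.
have ob : #[b] <= (2 ^ n.+1)%N by rewrite dvdn_leq ?expn_gt0 // order_dvdn b0.
(* The upper bounds multiply to exactly the lower bound, so both are attained. *)
have e2 : (2 ^ (n + 4) = 2 * 4 * 2 ^ n.+1)%N by rewrite expnD [(2 ^ n.+1)%N]expnS mulnA mulnC.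
have oaE : #[a] = 4%N by have := expn_gt0 2 n.+1; nia.
have obE : #[b] = (2 ^ n.+1)%N by have := expn_gt0 2 n.+1; nia.
have na2 : a ^+ 2 != 1 by rewrite -order_dvdn oaE.
have xp0 : 0 < x.-1 by rewrite -ltnS prednK // ltn_neqAle eq_sym x1.
split=> //.
- by apply/eqP; rewrite eqn_leq ge_P e2 andbT; move: le_P; rewrite oaE obE.
(* In class at most 2, [c] would centralise [a], and [#[a] = 4] would divide [x.-1]. *)
- apply/eqP; rewrite eqn_leq nilP ltnNge nil_class2; apply/negP => sPZ.
  have cZ : [~ a, b] \in 'Z(<<[set a; b]>>).
    by rewrite (subsetP sPZ) // mem_commg ?mem_gen ?set21 ?set22.
  have := @mac_commX _ a b x y 1 rab x0; rewrite expg1 mul1n oaE.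
  have ac : commute a [~ a, b].
    by case/setIP: cZ => _ /centP/(_ a) cZ; apply/commute_sym/cZ; rewrite mem_gen ?set21.
  by move/(_ ac); rewrite -[4%N]/(2 ^ 2)%N pfactor_dvdn // vx.
- have /(dvdn_pfactor _ _ (isT : prime 2))[m m2 oc] : #[[~ a, b]] %| 2 ^ 2.
    by rewrite order_dvdn (expgM _ 2 2) ca -expgM a4.
  have : ~~ (#[[~ a, b]] %| 2) by rewrite order_dvdn ca.
  by rewrite oc; case: m m2 {oc} => [|[|[|]]].
Qed.

(** * A group attaining the bounds *)

Local Open Scope nat_scope.

(** Here [n = k.+2]. The bits encode the quaternion part, so that its identities reduce to finite
    case analysis. *)
Definition mac2_group (k : nat) : Type := ('Z_(2 ^ k.+3) * (bool * bool * bool))%type.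

HB.instance Definition _ k := Finite.on (mac2_group k).

(** The action of [b] has order 4, so only the two lowest bits of its exponent matter; the carry,
    which records a factor [z], leaves them unchanged. *)
Definition Zp_lo k (j : 'Z_(2 ^ k.+3)) : bool := odd j.
Definition Zp_hi k (j : 'Z_(2 ^ k.+3)) : bool := odd j./2.
Definition Zp_carry k (e : bool) : 'Z_(2 ^ k.+3) := if e then ((2 ^ k.+2)%:R)%R else 0%R.

Lemma expn_trunc k : (Zp_trunc (2 ^ k.+3)).+2 = 2 ^ k.+3.
Proof. by rewrite Zp_cast // (ltn_exp2l 0). Qed.

Lemma dvdn4_trunc k : 4 %| (Zp_trunc (2 ^ k.+3)).+2.
Proof. by rewrite expn_trunc (@dvdn_exp2l 2 2). Qed.

Lemma odd_half_mod x d : 4 %| d -> odd (x %% d) = odd x /\ odd (x %% d)./2 = odd x./2.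
Proof.
case/dvdnP=> m ->; rewrite {2 4}(divn_eq x (m * 4)).
have -> : x %/ (m * 4) * (m * 4) = (x %/ (m * 4) * m).*2.*2 by rewrite -!muln2; ring.
by rewrite halfD !oddD !odd_double doubleK odd_double.
Qed.

Lemma Zp_loD k (i j : 'Z_(2 ^ k.+3)) : Zp_lo (i + j)%R = Zp_lo i (+) Zp_lo j.
Proof.
by rewrite /Zp_lo /=; have [-> _] := odd_half_mod (i + j) (dvdn4_trunc k); rewrite oddD.
Qed.

Lemma Zp_hiD k (i j : 'Z_(2 ^ k.+3)) :
  Zp_hi (i + j)%R = Zp_hi i (+) Zp_hi j (+) (Zp_lo i && Zp_lo j).
Proof.
rewrite /Zp_lo /Zp_hi /=; have [_ ->] := odd_half_mod (i + j) (dvdn4_trunc k).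
by rewrite halfD !oddD oddb addbC.
Qed.

Lemma Zp_lo_carry k e : Zp_lo (Zp_carry k e) = false.
Proof.
case: e; rewrite /Zp_lo //= val_Zp_nat ?(ltn_exp2l 0) // modn_small ?ltn_exp2l //.
by rewrite oddX.
Qed.

Lemma Zp_hi_carry k e : Zp_hi (Zp_carry k e) = false.
Proof.
case: e; rewrite /Zp_hi //= val_Zp_nat ?(ltn_exp2l 0) // modn_small ?ltn_exp2l //.
by rewrite expnS mul2n doubleK oddX.
Qed.

Lemma Zp_carryD k e f : (Zp_carry k e + Zp_carry k f = Zp_carry k (e (+) f))%R.
Proof.
case: e f => [] []; rewrite /Zp_carry /= ?addr0 ?add0r // -natrD addnn -mul2n -expnS.
by rewrite pchar_Zp ?(ltn_exp2l 0).
Qed.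

(* [(j, (p, q, r))] stands for [b ^ j * a ^ (2 p + q) * c ^ r], where [a] and
   [c] generate a quaternion group and [b] acts by [a -> a c], [c -> z c], with
   [z = b ^ (2 ^ (k + 2))] central of order 2. *)
Definition mac2_mul k (s t : mac2_group k) : mac2_group k :=
  let: (j, (p, q, r)) := s in let: (j', (p', q', r')) := t in
  let r1 := r (+) (Zp_lo j' && q) in
  let p1 := p (+) (Zp_hi j' && q) (+) [&& Zp_lo j', q & r] in
  ((j + j' + Zp_carry k ((Zp_hi j' && q) (+) (Zp_lo j' && r)))%R,
   (p1 (+) p' (+) (q && q') (+) (r1 && q') (+) (r1 && r'), q (+) q', r1 (+) r')).

Definition mac2_one k : mac2_group k := (0%R, (false, false, false)).

(** The inverse of [b ^ j * w] is [b ^ (- j)] times the conjugate of [w^-1] by [b ^ (- j)]. Negating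
    [j] keeps the low bit and flips the next one when the low bit is set, whence [r'] where
    [mac2_mul] has [r]. *)
Definition mac2_inv k (s : mac2_group k) : mac2_group k :=
  let: (j, (p, q, r)) := s in
  let P := p (+) (r || q) in
  let r' := r (+) (Zp_lo j && q) in
  let p' := P (+) (Zp_hi j && q) (+) [&& Zp_lo j, q & r'] in
  ((- (j + Zp_carry k ((Zp_hi j && q) (+) (Zp_lo j && r'))))%R, (p', q, r')).

Lemma mac2_mulA k : associative (@mac2_mul k).
Proof.
move=> [j1 [[p1 q1] r1]] [j2 [[p2 q2] r2]] [j3 [[p3 q3] r3]]; rewrite /mac2_mul.
rewrite !Zp_loD !Zp_hiD !Zp_lo_carry !Zp_hi_carry !andbF !addbF.
move: (Zp_lo j2) (Zp_hi j2) (Zp_lo j3) (Zp_hi j3) => l2 h2 l3 h3.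
congr (_, _).
  rewrite -!addrA; congr (_ + (_ + _))%R.
  rewrite [RHS]addrCA !Zp_carryD; congr (_ + Zp_carry k _)%R.
  by move: l2 h2 l3 h3 q1 r1 q2 r2 => [] [] [] [] [] [] [] [].
congr (_, _, _).
- by move: l2 h2 l3 h3 q1 r1 q2 r2 p1 p2 p3 q3 r3 => [] [] [] [] [] [] [] [] [] [] [] [] [].
- by rewrite addbA.
- by move: l2 h2 l3 h3 q1 r1 q2 r2 r3 => [] [] [] [] [] [] [] [] [].
Qed.

Lemma mac2_mul1 k : left_id (mac2_one k) (@mac2_mul k).
Proof.
move=> [j [[p q] r]]; rewrite /mac2_mul /mac2_one !andbF /=.
by rewrite add0r addr0 !addbF.
Qed.

Lemma mac2_mulV k : left_inverse (mac2_one k) (@mac2_inv k) (@mac2_mul k).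
Proof.
move=> [j [[p q] r]]; rewrite /mac2_mul /mac2_inv /mac2_one.
move: (Zp_lo j) (Zp_hi j) => l h; congr (_, _).
  by rewrite -addrA addNr.
by move: l h p q r => [] [] [] [] [].
Qed.

HB.instance Definition _ k := Finite_isGroup.Build (mac2_group k)
  (@mac2_mulA k) (@mac2_mul1 k) (@mac2_mulV k).

Local Open Scope group_scope.

Definition mac2_a k : mac2_group k := (0%R, (false, true, false)).
Definition mac2_b k : mac2_group k := (1%R, (false, false, false)).
Definition mac2_c k : mac2_group k := (0%R, (false, false, true)).

Lemma mac2_mulE k (s t : mac2_group k) : s * t = mac2_mul s t.
Proof. by []. Qed.

Lemma mac2_bX k i : mac2_b k ^+ i = (i%:R%R, (false, false, false)).
Proof.
elim: i => // i IH; rewrite expgSr IH mac2_mulE /mac2_mul /=.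
by rewrite addr0 -natr1.
Qed.

Lemma mac2_commE k : [~ mac2_a k, mac2_b k] = mac2_c k.
Proof.
rewrite commgEl; apply: (mulgI (mac2_a k)); rewrite mulKVg.
apply: (mulgI (mac2_b k)); rewrite -conjgC !mac2_mulE /mac2_mul /=.
by rewrite /Zp_carry ?addr0 ?add0r.
Qed.

Lemma mac2_a4 k : mac2_a k ^+ 4 = 1.
Proof.
rewrite !expgS expg0 mulg1 !mac2_mulE /mac2_mul /= ?add0r.
by rewrite /Zp_carry ?addr0.
Qed.

Lemma mac2_card k : #|[set: mac2_group k]| = (2 ^ (k.+2 + 4))%N.
Proof.
rewrite cardsT !card_prod card_bool card_ord expn_trunc -[(2 * 2 * 2)%N]/(2 ^ 3)%N -expnD.
by congr (2 ^ _)%N; rewrite !addnS.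
Qed.

Lemma mac2_conja k : mac2_a k ^ [~ mac2_a k, mac2_b k] = mac2_a k ^+ 3.
Proof.
rewrite mac2_commE; apply: (mulgI (mac2_c k)); rewrite -conjgC.
rewrite !expgS expg0 mulg1 !mac2_mulE /mac2_mul /= ?add0r.
by rewrite /Zp_carry ?addr0.
Qed.

Lemma mac2_conjb k : mac2_b k ^ [~ mac2_b k, mac2_a k] = mac2_b k ^+ (2 ^ k.+2).+1.
Proof.
rewrite -invg_comm mac2_commE conjgE invgK; apply: (mulIg (mac2_c k)); rewrite !mulgA mulgKV.
rewrite mac2_bX !mac2_mulE /mac2_mul /= ?add0r.
by rewrite /Zp_carry ?addr0 -natr1 addrC.
Qed.

Lemma mac2_gen k : <<[set mac2_a k; mac2_b k]>> = [set: mac2_group k].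
Proof.
apply/eqP; rewrite eqEsubset subsetT; apply/subsetP=> -[j [[p q] r]] _.
have aG : mac2_a k \in <<[set mac2_a k; mac2_b k]>> by rewrite mem_gen ?set21.
have bG : mac2_b k \in <<[set mac2_a k; mac2_b k]>> by rewrite mem_gen ?set22.
have cG : mac2_c k \in <<[set mac2_a k; mac2_b k]>> by rewrite -mac2_commE groupR.
suff -> : (j, (p, q, r)) = mac2_b k ^+ j * mac2_a k ^+ (p.*2 + q) * mac2_c k ^+ r.
  by rewrite !groupM ?groupX.
rewrite mac2_bX natr_Zp.
by case: p q r => [] [] [];
  rewrite /= ?expgS ?expg0 ?mulg1 ?mac2_mulE /mac2_mul /= /Zp_carry ?addr0.
Qed.

Lemma mac2_bN k : mac2_b k ^+ (2 ^ k.+3) = 1.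
Proof. by rewrite mac2_bX pchar_Zp // (ltn_exp2l 0). Qed.

(** * Passing to the Sylow 2-subgroup *)

Local Open Scope group_scope.

Lemma zexpg_mod (gT : finGroupType) (g : gT) (z : int) (x N : nat) :
  g ^+ N = 1 -> (Posz N %| (z - Posz x)%R)%Z -> zexpg g z = g ^+ x.
Proof.
move=> gN; rewrite dvdzE /=; case: z => m /= dv.
  apply/eqP; rewrite eq_expg_mod_order; apply/eqP.
  have gdv : #[g] %| N by rewrite order_dvdn gN.
  have/eqP : (Posz m == Posz x %[mod Posz #[g]])%Z.
    by rewrite eqz_mod_dvd dvdzE; apply: dvdn_trans gdv dv.
  by rewrite !modz_nat => -[].
apply: (mulgI (g ^+ m.+1)); rewrite mulgV -expgD; apply/esym/eqP.
rewrite -order_dvdn; apply: dvdn_trans (_ : N %| _); first by rewrite order_dvdn gN.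
by move: dv; rewrite NegzE -opprD abszN -PoszD.
Qed.

(** Allows integer exponents to be replaced by positive natural ones without changing the
    valuation. *)
Lemma int_residue (z : int) (e M : nat) :
  (z != 1)%R -> logn 2 (absz (z - 1)%R) = e -> 0 < e -> 0 < M -> (2 ^ e.+1 %| M)%N ->
  exists x : nat, [/\ (Posz M %| (z - Posz x)%R)%Z, 0 < x, x != 1%N & logn 2 x.-1 = e].
Proof.
move=> z1 ve e0 M0 dM; set x := absz (z %% Posz M)%Z.
have xE : Posz x = (z %% Posz M)%Z.
  by rewrite /x gez0_abs // modz_ge0 // eqz_nat -lt0n.
have dx : (Posz M %| (z - Posz x)%R)%Z.
  by rewrite xE {1}(divz_eq z (Posz M)) addrK dvdz_mull.
have zp : 0 < absz (z - 1)%R by rewrite absz_gt0 subr_eq0.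
(* The case [k = 1] excludes [x = 0], the case [k = e.+1] excludes [x = 1], and [k = e], [e.+1] give
   the valuation. *)
have dvE k : k <= e.+1 -> (Posz (2 ^ k)%N %| (Posz x - 1)%R)%Z = (k <= e).
  move=> ke; rewrite -ve -pfactor_dvdn // -[RHS]/(Posz (2 ^ k)%N %| (z - 1)%R)%Z.
  have dk : (Posz (2 ^ k)%N %| (z - Posz x)%R)%Z.
    by apply: dvdz_trans dx; rewrite dvdzE /=; apply: dvdn_trans dM; apply: dvdn_exp2l.
  have -> : (z - 1 = (Posz x - 1) + (z - Posz x))%R by ring.
  by rewrite -[LHS](rpredDr _ dk).
exists x.
have x0 : 0 < x.
  rewrite lt0n; apply/eqP=> x_0; have := dvE 1%N; rewrite x_0 e0 ltnS => /(_ isT).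
  by rewrite dvdzE.
have xpE : (Posz x - 1 = Posz x.-1)%R by rewrite -{1}(prednK x0) -addn1 PoszD addrK.
have x1 : x != 1%N.
  by apply/eqP=> x_1; have := dvE e.+1 (leqnn _); rewrite x_1 subrr dvdz0 ltnn.
split=> //.
have xp0 : 0 < x.-1 by rewrite -ltnS prednK // ltn_neqAle eq_sym x1.
apply/eqP; rewrite eqn_leq -pfactor_dvdn // leqNgt -pfactor_dvdn //.
have := dvE e (leqnSn e); have := dvE e.+1 (leqnn _).
by rewrite xpE !dvdzE /= leqnn ltnn => -> ->.
Qed.

(** A nilpotent group is the direct product of ['O_pi(G)] and ['O_pi^'(G)], and the constituent is
    the first projection. *)
Lemma constt_nilM (gT : finGroupType) (G : {group gT}) (pi : nat_pred) :
  nilpotent G -> {in G &, {morph (fun x => x.`_pi) : x y / x * y}}.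
Proof.
move=> nilG x y Gx Gy /=.
have [_ defG cK _] := dprodP (nilpotent_pcoreC pi nilG).
have mem (rho : nat_pred) t : t \in G -> t.`_rho \in 'O_rho(G).
  move=> Gt; rewrite (mem_normal_Hall (nilpotent_pcore_Hall rho nilG) (pcore_normal _ _)).
    exact: p_elt_constt.
  by rewrite /constt groupX.
have Hxy : x.`_pi * y.`_pi \in 'O_pi(G) by rewrite groupM ?mem.
have Kxy : x.`_pi^' * y.`_pi^' \in 'O_pi^'(G) by rewrite groupM ?mem.
have cHK h k : h \in 'O_pi(G) -> k \in 'O_pi^'(G) -> commute h k.
  by move=> Hh Kk; apply/commute_sym/(centsP cK).
have -> : x * y = (x.`_pi * y.`_pi) * (x.`_pi^' * y.`_pi^').
  rewrite -{1}(consttC pi x) -{1}(consttC pi y) -!mulgA; congr (_ * _).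
  by rewrite !mulgA; congr (_ * _); apply/commute_sym/cHK; apply: mem.
rewrite consttM; last exact: cHK.
rewrite constt_p_elt; last by apply: mem_p_elt (pcore_pgroup _ _) Hxy.
have /constt1P-> := mem_p_elt (pcore_pgroup _ _) Kxy.
by rewrite mulg1.
Qed.

Lemma nilpotent_constt_gen (gT : finGroupType) (G P : {group gT}) (pi : nat_pred) (a b : gT) :
  nilpotent G -> pi.-Hall(G) P -> <<[set a; b]>> = G -> <<[set a.`_pi; b.`_pi]>> = P.
Proof.
move=> nilG hallP defG; have piM := @constt_nilM _ _ pi nilG.
pose f := Morphism piM.
have sabG : [set a; b] \subset G by rewrite -defG subset_gen.
have [aG bG] : a \in G /\ b \in G by split; apply: (subsetP sabG); rewrite ?set21 ?set22.
have <- : f @* G = <<[set a.`_pi; b.`_pi]>>.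
  by rewrite -[X in _ @* X]defG morphim_gen // morphimU !morphim_set1.
have PE := nilpotent_Hall_pcore nilG hallP.
have memP x : x \in G -> (x \in P) = pi.-elt x.
  by move=> Gx; rewrite PE (mem_normal_Hall (nilpotent_pcore_Hall pi nilG) (pcore_normal _ _)).
apply/eqP; rewrite eqEsubset; apply/andP; split; apply/subsetP => x.
  case/morphimP=> y _ Gy -> /=; rewrite memP ?p_elt_constt //.
  by rewrite /constt groupX.
move=> Px; have Gx := subsetP (pHall_sub hallP) x Px.
have -> : x = f x by rewrite /= constt_p_elt // -memP.
exact: mem_morphim.
Qed.

Lemma constt_nilR (gT : finGroupType) (G : {group gT}) (pi : nat_pred) (a b : gT) :
  nilpotent G -> a \in G -> b \in G -> [~ a, b].`_pi = [~ a.`_pi, b.`_pi].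
Proof.
move=> nilG aG bG; have piM := @constt_nilM _ _ pi nilG.
exact: (morphR (Morphism piM) aG bG).
Qed.

Lemma mac_rel_constt (gT : finGroupType) (G : {group gT}) (pi : nat_pred) (a b : gT) x y :
  nilpotent G -> a \in G -> b \in G ->
  mac_rel a b x y -> mac_rel a.`_pi b.`_pi x y.
Proof.
move=> nilG aG bG [ac bc]; have piM := @constt_nilM _ _ pi nilG.
pose f := Morphism piM; rewrite /mac_rel -!consttX -ac -bc.
rewrite -[a.`_pi]/(f a) -[b.`_pi]/(f b) -!morphR // -!morphJ ?groupR //.
Qed.

Lemma eval_zexpt (gT : finGroupType) (e : seq gT) t (z : int) :
  Presentation.eval e (zexpt t z) = zexpg (Presentation.eval e t) z.
Proof. by case: z. Qed.

Lemma hom_Gpres (gT : finGroupType) (a b : gT) (alpha beta : int) :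
  a ^ [~ a, b] = zexpg a alpha -> b ^ [~ b, a] = zexpg b beta ->
  Presentation.hom <<[set a; b]>> (Gpres alpha beta).
Proof.
move=> ra rb; apply/existsP; exists (a, b) => /=.
by rewrite !eval_zexpt /= ra rb joing_idl joing_idr.
Qed.

Lemma mac2_zexpga k (z : int) (x N : nat) : 4 %| N -> (Posz N %| (z - Posz x)%R)%Z ->
  0 < x -> x != 1%N -> logn 2 x.-1 = 1%N ->
  mac2_a k ^ [~ mac2_a k, mac2_b k] = zexpg (mac2_a k) z.
Proof.
move=> N4 dx x0 x1 vx; rewrite mac2_conja (zexpg_mod _ dx); last first.
  by apply/eqP; rewrite -order_dvdn; apply: dvdn_trans N4; rewrite order_dvdn mac2_a4.
have xp0 : 0 < x.-1 by rewrite -ltnS prednK // ltn_neqAle eq_sym x1.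
have [h oh def_x] := logn2_odd xp0.
(* Valuation 1 means [x] is 3 modulo 4, the exponent in the model. *)
have -> : x = (3 + 4 * h./2)%N.
  by rewrite -(prednK x0) def_x vx -{1}(odd_double_half h) oh; lia.
by rewrite expgD expgM mac2_a4 expg1n mulg1.
Qed.

Lemma mac2_zexpgb k (z : int) (y N : nat) :
  (2 ^ k.+3 %| N)%N -> (Posz N %| (z - Posz y)%R)%Z ->
  0 < y -> y != 1%N -> logn 2 y.-1 = k.+2 ->
  mac2_b k ^ [~ mac2_b k, mac2_a k] = zexpg (mac2_b k) z.
Proof.
move=> dN dy y0 y1 vy; rewrite mac2_conjb (zexpg_mod _ dy); last first.
  by apply/eqP; rewrite -order_dvdn; apply: dvdn_trans dN; rewrite order_dvdn mac2_bN.
have yp0 : 0 < y.-1 by rewrite -ltnS prednK // ltn_neqAle eq_sym y1.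
have [u ou def_y] := logn2_odd yp0.
have -> : y = ((2 ^ k.+2).+1 + 2 ^ k.+3 * u./2)%N.
  by rewrite -(prednK y0) def_y vy -{1}(odd_double_half u) ou [(2 ^ k.+3)%N]expnS; lia.
by rewrite expgD expgM mac2_bN expg1n mulg1.
Qed.

Theorem theorem12p2 (alpha beta : int) (n : nat)
  (gT : finGroupType) (G : {group gT}) (A B : gT) :
  (alpha != 1)%R -> (beta != 1)%R ->
  logn 2 (absz (alpha - 1)%R) = 1%N ->
  logn 2 (absz (beta - 1)%R) = n -> (2 < n)%N ->
  Presentation.iso G (Gpres alpha beta) ->
  <<[set A; B]>>%g = G ->
  (A ^ [~ A, B])%g = zexpg A alpha ->
  (B ^ [~ B, A])%g = zexpg B beta ->
  forall P : {group gT}, P \in ('Syl_2(G))%g ->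
    [/\ #|P| = (2 ^ (n + 4))%N,
        nil_class P = 3%N,
        #[(A.`_2)%g]%g = 4%N,
        #[([~ A, B].`_2)%g]%g = 4%N
      & #[(B.`_2)%g]%g = (2 ^ n.+1)%N].
Proof.
move=> alpha1 beta1 va vb n2 isoG defG relA relB P.
rewrite inE => sylP.
have [k def_n] : exists k, n = k.+2 by case: (n) n2 => [|[|k]] // _; exists k.
(* The factor [#|G|] makes reduction modulo [M] harmless in [G]; the power of 2 preserves the
   valuations and covers the orders of the model's generators. *)
pose M := (2 ^ n.+3 * #|G|)%N.
have M0 : 0 < M by rewrite muln_gt0 expn_gt0 cardG_gt0.
have dvdM e : e <= n.+3 -> (2 ^ e %| M)%N by move=> le_e; rewrite dvdn_mulr // dvdn_exp2l.
have [x [dx x0 x1 vx]] := int_residue alpha1 va isT M0 (dvdM 2%N isT).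
have [y [dy y0 y1 vy]] := int_residue beta1 vb (ltnW (ltnW n2)) M0 (dvdM n.+1 (ltnW (leqnSn _))).
have aG : A \in G by rewrite -defG mem_gen ?set21.
have bG : B \in G by rewrite -defG mem_gen ?set22.
have GM g : g \in G -> g ^+ M = 1 by move=> Gg; rewrite /M mulnC expgM expg_cardG ?expg1n.
have rAB : mac_rel A B x y.
  by split; [rewrite relA (zexpg_mod (GM A aG) dx) | rewrite relB (zexpg_mod (GM B bG) dy)].
have nilG : nilpotent G by rewrite -defG; apply: (mac_nilpotent rAB).
have genP := nilpotent_constt_gen nilG sylP defG.
have rP := mac_rel_constt 2 nilG aG bG rAB.
(* The model satisfies the presentation, so it is an image of [G] and its order [2 ^ (n + 4)]
   divides [#|G|]. *)
have homQ : [set: mac2_group k] \homg G.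
  rewrite -mac2_gen isoG; rewrite def_n in vy.
  apply: hom_Gpres.
    exact: mac2_zexpga (dvdM 2 isT) dx x0 x1 vx.
  by apply: mac2_zexpgb dy y0 y1 vy; rewrite -def_n dvdM // leqW.
have geP : 2 ^ (n + 4) <= #|P|.
  rewrite (card_Hall sylP) dvdn_leq //; have := card_homg homQ.
  rewrite mac2_card -def_n => /(partn_dvd 2 (cardG_gt0 G)).
  by rewrite part_pnat_id // pnatX.
rewrite (constt_nilR 2 nilG aG bG).
rewrite -genP in geP *.
by apply: mac2_structure rP _ _ _ _ _ _ vx vy n2 geP; rewrite ?p_elt_constt.
Qed.
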